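(* Let $H$ be a hypergraph of rank $3$. Then \[ \frac{\rho(H)}{\rho^*(H)} \le \frac{3}{2}. \]
   Context: A hypergraph $H=(V,E)$ consists of a non-empty finite set $V=V(H)$ of vertices and a family $E=E(H)$ of subsets of $V$ called edges; all edges are non-empty and every vertex belongs to at least one edge, so $V=\bigcup E$. The rank of $H$ is $\max_{e\in E}|e|$. An edge cover in $H$ is a subfamily $E'\subseteq E$ with $\bigcup E'=V$, and $\rho(H)$ is the minimum of $|E'|$ over all edge covers $E'$. A fractional edge cover in $H$ is a function $f:E\to\mathbb{R}_+$ (non-negative reals) with $\sum_{e\ni v}f(e)\ge 1$ for every $v\in V$; its size is $|f|=\sum_{e\in E}f(e)$, and $\rho^*(H)$ is the minimum of $|f|$ over all fractional edge covers $f$. *)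

(* Defs.v *)
From mathcomp Require Import all_boot all_order all_algebra.
From mathcomp Require Import all_classical all_reals all_analysis.

Set Implicit Arguments.
Unset Strict Implicit.
Unset Printing Implicit Defensive.

Import Order.TTheory GRing.Theory Num.Theory.
Import numFieldNormedType.Exports.

Local Open Scope ring_scope.

Record hypergraph := Hypergraph {
  vertex :> finType;
  edges : {set {set vertex}};
  vertex_gt0 : (0 < #|vertex|)%N;
  edges_neq0 : finset.set0 \notin edges;
  edges_cover : finset.cover edges = [set: vertex]
}.

Section EdgeCovers.
Variables (R : realType) (H : hypergraph).

Definition rank : nat := \max_(e in edges H) #|e|.

Definition edge_cover (E' : {set {set H}}) : bool :=
  (E' \subset edges H) && (finset.cover E' == [set: H]).

Definition rho : nat := #|[arg min_(E' < edges H | edge_cover E') #|E'| ]|.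

Lemma edge_cover_edges : edge_cover (edges H).
Proof. by rewrite /edge_cover subxx edges_cover eqxx. Qed.

Lemma rho_attained : exists2 E', edge_cover E' & #|E'| = rho.
Proof.
rewrite /rho; case: arg_minnP => [|E' E'P _]; first exact: edge_cover_edges.
by exists E'.
Qed.

Lemma rho_le E' : edge_cover E' -> (rho <= #|E'|)%N.
Proof.
by rewrite /rho; case: arg_minnP => [|E0 _]; [exact: edge_cover_edges|exact].
Qed.

(* Only the restriction of f to the edges is constrained or used, so f stands
   for a function from the edges of H to the nonnegative reals. *)
Definition fractional_edge_cover (f : {set H} -> R) : Prop :=
  (forall e, e \in edges H -> 0 <= f e) /\
  (forall v : H, 1 <= \sum_(e in edges H | v \in e) f e).

Definition fsize (f : {set H} -> R) : R := \sum_(e in edges H) f e.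

(* The infimum is a minimum: see rho_star_attained and rho_star_le. *)
Definition rho_star : R :=
  inf [set fsize f | f in fractional_edge_cover]%classic.

Lemma fractional_edge_cover1 : fractional_edge_cover (fun=> 1).
Proof.
split=> // v; have : v \in finset.cover (edges H) by rewrite edges_cover finset.in_setT.
move=> /bigcupP[e eE ve]; rewrite (bigD1 e) ?eE//= lerDl.
by rewrite sumr_ge0.
Qed.

Lemma rho_star_le f : fractional_edge_cover f -> rho_star <= fsize f.
Proof.
move=> fP; apply: ge_inf; last by exists f.
by exists 0 => _ [g [g0 _] <-]; exact: sumr_ge0.
Qed.

Lemma rho_star_attained :
  exists2 f, fractional_edge_cover f & fsize f = rho_star.
Proof.
pose X := prod_topology (fun _ : {set H} => R : topologicalType).
have sumC (P : pred {set H}) : continuous (fun f : X => \sum_(e | P e) f e).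
  apply: continuous_big => [|e _]; [exact: add_continuous|].
  exact: (@proj_continuous _ (fun _ : {set H} => R : topologicalType) e).
pose box := [set f : X | forall e, `[(0 : R), 1]%classic (f e)]%classic.
pose above (v : H) := [set f : X | 1 <= \sum_(e in edges H | v \in e) f e]%classic.
pose K := (box `&` \bigcap_(v in @classical_sets.setT H) above v)%classic.
have Kcompact : compact K.
  have boxC : compact box.
    exact: (@tychonoff _ (fun _ : {set H} => R : topologicalType) _
              (fun=> @segment_compact R 0 1)).
  apply: (subclosed_compact _ boxC); last by move=> f [].
  apply: closedI.
  - apply: compact_closed boxC.
    by apply: hausdorff_product => e; exact: Rhausdorff.
  - apply: closed_bigI => v _.
    apply: (@preimage_closed _ _ (fun f : X => \sum_(e in edges H | v \in e) f e)
             [set y | 1 <= y]%classic); last exact: closed_ge.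
    by move=> f _; exact: sumC.
have K1 : K (fun=> 1).
  split=> [e|v _] /=; first by rewrite in_itv/= ler01 lexx.
  by have [_] := fractional_edge_cover1; exact.
have [f fK fmin] := @compact_EVT_min X R (@fsize : X -> R) K
  (ex_intro _ _ K1) Kcompact (continuous_subspaceT (sumC _)).
move: fK; rewrite inE => -[f01 fcov].
have fP : fractional_edge_cover f.
  split=> [e _|v]; last exact: fcov.
  by have /= := f01 e; rewrite in_itv/= => /andP[].
exists f => //; apply/eqP; rewrite eq_le rho_star_le// andbT.
apply: lb_le_inf; first by exists (fsize f), f.
move=> _ [g [g0 gcov] <-].
pose h (e : {set H}) : R := if e \in edges H then Num.min (g e) 1 else 0.
have h0 e : 0 <= h e.
  by rewrite /h; case: ifPn => // eE; rewrite le_min g0//= ler01.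
apply: (@le_trans _ _ (fsize h)); last first.
  by apply: ler_sum => e eE; rewrite /h eE ge_min lexx.
apply: fmin; rewrite inE; split=> [e|v _] /=.
  rewrite in_itv/= h0/= /h; case: ifPn => // _.
  by rewrite ge_min lexx orbT.
have [[e /andP[eE /andP[ve ge1]]]|small] :=
    pselect (exists e, [&& e \in edges H, v \in e & 1 <= g e]).
  rewrite /above/= (bigD1 e) ?eE//= {1}/h eE (min_idPr ge1) lerDl.
  by rewrite sumr_ge0.
rewrite /above/=; apply: le_trans (gcov v) _; apply: ler_sum => e /andP[eE ve].
rewrite /h eE le_min lexx/= leNgt; apply/negP => /ltW ge1.
by apply: small; exists e; rewrite eE ve.
Qed.

End EdgeCovers.

Arguments rho_star : clear implicits.

(* Main.v *)
Require Import Defs.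
From mathcomp Require Import all_classical all_reals all_analysis.
From mathcomp Require Import all_boot all_order all_algebra.
From mathcomp Require Import lra zify.

(* The stronger bound rho(X) <= |f| + |X|/6 holds for every fractional cover f of a vertex
   set X by edges of size at most 3; as |V| <= 3 rho*, it gives rho <= (3/2) rho*.
   In a minimal counterexample, wt(Y) + |Y|/6 < k for every nonempty Y in X that k edges
   cover, where wt(Y) is the weight of the edges whose trace on X is nonempty and lies in
   Y: otherwise delete Y. In particular f(e) + |e|/6 < 1 for every trace e. Linear algebra
   lets us assume that at most |X| edges have positive weight. A discharging argument then
   shows that every vertex lies in exactly three edges of the support, all of size 3, so
   that |f| >= |X|/3; but the argument of Chvatal and McDiarmid covers X by |X|/2 edges. *)

Set Implicit Arguments.
Unset Strict Implicit.
Unset Printing Implicit Defensive.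

Import Order.TTheory GRing.Theory Num.Theory.

Local Open Scope ring_scope.

(** * Covers and weights *)

Definition coverable (T : finType) (E : {set {set T}}) (X : {set T}) (k : nat) :=
  exists C : {set {set T}}, [/\ C \subset E, X \subset cover C & (#|C| <= k)%N].

Lemma coverable0 (T : finType) (E : {set {set T}}) : coverable E set0 0.
Proof. by exists set0; split; rewrite ?sub0set ?cards0. Qed.

Lemma coverable1 (T : finType) (E : {set {set T}}) (e X : {set T}) :
  e \in E -> X \subset e -> coverable E X 1.
Proof. by move=> eE Xe; exists [set e]; rewrite sub1set /cover big_set1 cards1. Qed.

Lemma coverableU (T : finType) (E : {set {set T}}) (X Y : {set T}) (k l : nat) :
  coverable E X k -> coverable E Y l -> coverable E (X :|: Y) (k + l).
Proof.
move=> [C [CE XC Ck]] [D [DE YD Dl]]; exists (C :|: D); split.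
- by rewrite subUset CE DE.
- by rewrite /cover bigcup_setU; apply: setUSS.
- by rewrite (leq_trans (leq_card_setU _ _)) ?leq_add.
Qed.

Lemma coverableS (T : finType) (E : {set {set T}}) (X Y : {set T}) (k l : nat) :
  Y \subset X -> (k <= l)%N -> coverable E X k -> coverable E Y l.
Proof.
move=> YX kl [C [CE XC Ck]]; exists C; split=> //; first exact: subset_trans XC.
exact: leq_trans kl.
Qed.

Definition star (T : finType) (S : {set {set T}}) (v : T) : {set {set T}} :=
  [set e in S | v \in e].

Definition meeting (T : finType) (S : {set {set T}}) (X : {set T}) : {set {set T}} :=
  [set e in S | e :&: X != set0].

Definition wt (R : numDomainType) (T : finType) (E : {set {set T}})
    (f : {set T} -> R) (X Y : {set T}) : R :=
  \sum_(e in meeting E X | e :&: X \subset Y) f e.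

Definition fcover (R : numDomainType) (T : finType) (E : {set {set T}})
    (f : {set T} -> R) (X : {set T}) : Prop :=
  (forall e, e \in E -> 0 <= f e) /\
  (forall v, v \in X -> 1 <= \sum_(e in star E v) f e).

Definition fsupp (R : numDomainType) (T : finType) (E : {set {set T}})
    (f : {set T} -> R) (X : {set T}) : {set {set T}} :=
  [set e in meeting E X | 0 < f e].

Lemma fcoverS (R : numDomainType) (T : finType) (E : {set {set T}})
    (f : {set T} -> R) (X Y : {set T}) :
  Y \subset X -> fcover E f X -> fcover E f Y.
Proof. by move=> YX [f0 f1]; split=> // v /(subsetP YX); exact: f1. Qed.

Lemma meeting_setD (T : finType) (E : {set {set T}}) (X Y : {set T}) :
  Y \subset X ->
  meeting E (X :\: Y) = [set e in meeting E X | ~~ (e :&: X \subset Y)].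
Proof.
move=> YX; apply/setP=> e; rewrite !inE -!andbA; congr (_ && _).
by rewrite setIDA setD_eq0; case: eqVneq => [->|//]; rewrite sub0set.
Qed.

(** An edge that meets X stops meeting what remains after deleting Y exactly when its trace lies in
    Y. So the weight of X splits with no edge counted twice, which is what makes deletion an
    induction step. *)
Lemma wt_setD (R : numDomainType) (T : finType) (E : {set {set T}})
    (f : {set T} -> R) (X Y : {set T}) : Y \subset X ->
  wt E f X X = wt E f X Y + wt E f (X :\: Y) (X :\: Y).
Proof.
move=> YX; rewrite /wt meeting_setD // (bigID (fun e => e :&: X \subset Y)) /=.
congr (_ + _); apply: eq_bigl => e; first by rewrite subsetIr andbT.
by rewrite [in RHS]inE !subsetIr !andbT.
Qed.

(** * Cubic hypergraphs *)

(** Double counting of the incidences between Z and S. A general [F] lets it serve for degrees,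
    weights and shares alike. *)
Lemma sum_star (V : nmodType) (T : finType) (S : {set {set T}}) (Z : {set T})
    (F : {set T} -> T -> V) :
  \sum_(v in Z) \sum_(e in star S v) F e v =
  \sum_(e in meeting S Z) \sum_(v in e :&: Z) F e v.
Proof.
rewrite (exchange_big_dep (mem (meeting S Z))) /=.
  apply: eq_bigr => e; rewrite inE => /andP[eS _].
  by apply: eq_bigl => v; rewrite !inE eS andbC.
move=> v e vZ; rewrite !inE => /andP[-> ve] /=.
by apply/set0Pn; exists v; rewrite inE ve.
Qed.

Lemma card_bigcup_leq (T I : finType) (M : {set I}) (F : I -> {set T}) :
  (#|\bigcup_(i in M) F i| <= \sum_(i in M) #|F i|)%N.
Proof.
elim/big_rec2: _ => [|i n A _ IH]; first by rewrite cards0.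
by rewrite (leq_trans (leq_card_setU _ _)) // leq_add2l.
Qed.

Lemma coverable_card (T : finType) (S : {set {set T}}) (Z : {set T}) :
  (forall v, v \in Z -> exists2 e, e \in S & v \in e) -> coverable S Z #|Z|.
Proof.
move: {2}#|Z| (erefl #|Z|) => n; elim: n Z => [|n IH] Z Zn H.
  by rewrite Zn; move/eqP: Zn; rewrite cards_eq0 => /eqP->; exact: coverable0.
have /set0Pn[v vZ] : Z != set0 by rewrite -card_gt0 Zn.
rewrite (cardsD1 v) vZ -(setD1K vZ).
apply: coverableU.
  have [e eS ve] := H _ vZ.
  by apply: coverable1 eS _; rewrite sub1set.
rewrite setD1K //; apply: IH; first by move: Zn; rewrite (cardsD1 v) vZ => -[].
by move=> w; rewrite inE => /andP[_]; exact: H.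
Qed.

(** The counting analogue of [wt]: with unit weights, [wt] is the size of this set. *)
Definition inside (T : finType) (S : {set {set T}}) (Z Y : {set T}) : {set {set T}} :=
  [set e in meeting S Z | e :&: Z \subset Y].

Lemma inside_trace (T : finType) (S : {set {set T}}) (Z e : {set T}) :
  e \in meeting S Z -> e \in inside S Z (e :&: Z).
Proof. by move=> eS; rewrite inE eS subxx. Qed.

Lemma trace_coverable (T : finType) (S : {set {set T}}) (Z e : {set T}) :
  e \in meeting S Z -> coverable S (e :&: Z) 1.
Proof. by rewrite inE => /andP[eS _]; apply: coverable1 eS _; rewrite subsetIl. Qed.

Lemma trace_neq0 (T : finType) (S : {set {set T}}) (Z e : {set T}) :
  e \in meeting S Z -> e :&: Z != set0.
Proof. by rewrite inE => /andP[]. Qed.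

Lemma card_meeting_setD (T : finType) (S : {set {set T}}) (Z Y : {set T}) :
  Y \subset Z -> #|meeting S Z| = (#|inside S Z Y| + #|meeting S (Z :\: Y)|)%N.
Proof.
move=> YZ; rewrite meeting_setD // -(cardsID (inside S Z Y)).
congr (_ + _)%N; apply: eq_card => e; rewrite !inE.
  by case: (e \in S) (e :&: Z != set0) (e :&: Z \subset Y) => [] [] [].
by case: (e \in S) (e :&: Z != set0) (e :&: Z \subset Y) => [] [] [].
Qed.

Section Cubic.
Variables (T : finType) (S : {set {set T}}) (Z : {set T}).
Hypothesis deg3 : forall v, v \in Z -> #|star S v| = 3%N.
Hypothesis Z0 : Z != set0.
(** This holds in a counterexample to [cubic_coverable] with fewest vertices: if Y violated it, a
    cover of Y by k edges and a good cover of the rest would combine to a good cover of Z. *)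
Hypothesis irr : forall (Y : {set T}) (k : nat), Y \subset Z -> Y != set0 -> coverable S Y k ->
  (#|Y| + #|inside S Z Y| < 4 * k)%N.

Let irrT (e : {set T}) : e \in meeting S Z -> (#|e :&: Z| + #|inside S Z (e :&: Z)| < 4)%N.
Proof.
move=> eZ; have := irr (subsetIr _ _) (trace_neq0 eZ) (trace_coverable eZ).
by rewrite muln1.
Qed.

Let meetZ (v : T) (e : {set T}) : v \in Z -> e \in star S v -> e \in meeting S Z.
Proof.
by move=> vZ; rewrite !inE => /andP[-> ve]; apply/set0Pn; exists v; rewrite inE ve.
Qed.

(** Two edges inside a trace with at least two vertices would bring the sum in [irrT] to 4. *)
Let trace_inj2 (e e' : {set T}) : e \in meeting S Z -> e' \in meeting S Z ->
  (1 < #|e :&: Z|)%N -> e' :&: Z \subset e :&: Z -> e' = e.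
Proof.
move=> eZ e'Z e2 sub; apply/eqP; apply: contraT => ne.
have := irrT eZ; suff : (1 < #|inside S Z (e :&: Z)|)%N by lia.
rewrite (cardsD1 e) inside_trace // ltnS card_gt0; apply/set0Pn; exists e'.
by rewrite in_setD1 ne inE e'Z.
Qed.

(** By [irrT] a trace has at most two vertices. If it were a single vertex v, at most two edges
    would have that trace, so the third edge at v would have a larger trace containing it, against
    [trace_inj2]. *)
Let trace2 (e : {set T}) : e \in meeting S Z -> #|e :&: Z| = 2%N.
Proof.
move=> eZ; have := irrT eZ.
have : (0 < #|inside S Z (e :&: Z)|)%N.
  by rewrite card_gt0; apply/set0Pn; exists e; exact: inside_trace.
have := trace_neq0 eZ; rewrite -card_gt0 => t1 i1 i3.
have [t2|tn2] := eqVneq #|e :&: Z| 2%N; first by [].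
have /cards1P[v ev] : #|e :&: Z| == 1%N by lia.
have vZ : v \in Z by have : v \in e :&: Z; [rewrite ev set11 | rewrite inE => /andP[]].
have [e' e'v e'n] : exists2 e', e' \in star S v & e' \notin inside S Z (e :&: Z).
  apply/subsetPn; apply: contraTN i3 => /subset_leq_card; rewrite deg3 //; lia.
have e'Z := meetZ vZ e'v.
have sub : e :&: Z \subset e' :&: Z.
  by rewrite ev sub1set inE vZ andbT; move: e'v; rewrite inE => /andP[].
have e'2 : (1 < #|e' :&: Z|)%N.
  rewrite ltnNge; apply: contraNN e'n => e'1.
  rewrite inE e'Z /= (_ : e' :&: Z = e :&: Z) //; apply/eqP.
  by rewrite eq_sym eqEcard sub; lia.
by move: e'n; rewrite -(trace_inj2 e'Z eZ e'2 sub) inside_trace.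
Qed.
(** The traces are the edges of a graph on Z, and these are its matchings. *)
Let packing (M : {set {set T}}) : bool := (M \subset meeting S Z) &&
  [forall e in M, forall e' in M, (e != e') ==> (e :&: e' :&: Z == set0)].

Let packingP (M : {set {set T}}) : reflect
  (M \subset meeting S Z /\
   forall e e', e \in M -> e' \in M -> e != e' -> e :&: e' :&: Z = set0) (packing M).
Proof.
apply: (iffP andP) => -[MS H]; split=> //.
  move=> e e' eM e'M ne; apply/eqP.
  by move/forall_inP: H => /(_ e eM)/forall_inP/(_ e' e'M)/implyP; apply.
by apply/forall_inP => e eM; apply/forall_inP => e' e'M; apply/implyP => ne; rewrite H.
Qed.

Let packingU1 (M : {set {set T}}) (e : {set T}) : packing M -> e \in meeting S Z ->
  (forall m, m \in M -> e :&: m :&: Z = set0) -> packing (e |: M) /\ e \notin M.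
Proof.
move=> /packingP[MS dM] eZ eM; split; last first.
  by apply/negP=> /eM; rewrite setIid; apply/eqP; exact: trace_neq0 eZ.
apply/packingP; split; first by rewrite subUset sub1set eZ.
move=> a b; rewrite !inE => /orP[/eqP->|aM] /orP[/eqP->|bM] ab.
- by rewrite eqxx in ab.
- exact: eM.
- by rewrite (setIC a) eM.
- exact: dM.
Qed.

(* All traces are now pairs forming a simple cubic graph. For a maximum matching M with
   set U of uncovered vertices, the edges leaving U end in M, and at most two of them end
   in a given edge of M, since M has no augmenting path of length 3; so 3|U| <= 2|M|. *)
Lemma no_irreducible_cubic : False.
Proof.
have p0 : packing set0.
  by apply/packingP; split; [exact: sub0set | move=> e e'; rewrite inE].
have [M pM maxM] : exists2 M, packing M & forall M', packing M' -> (#|M'| <= #|M|)%N.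
  by case: (arg_maxnP (fun M : {set {set T}} => #|M|) p0) => M pM H; exists M.
have ext e : e \in meeting S Z -> exists2 m, m \in M & e :&: m :&: Z != set0.
  move=> eZ; apply/exists_inP; apply: contraT; rewrite negb_exists_in => /forall_inP H.
  have [|/maxM] := packingU1 pM eZ; first by move=> m /H; rewrite negbK => /eqP.
  by move=> le eM; move: le; rewrite cardsU1 eM; lia.
have [MS dM] := packingP _ pM.
pose U := Z :\: \bigcup_(m in M) m.
have UZ : U \subset Z by rewrite subsetDl.
have UM u m : u \in U -> m \in M -> u \notin m.
  by rewrite inE => /andP[+ _] mM; apply: contraNN => um; apply/bigcupP; exists m.
have meetU e : e \in meeting S U -> e \in meeting S Z.
  rewrite !inE => /andP[-> /set0Pn[v]]; rewrite inE => /andP[ve /(subsetP UZ) vZ].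
  by apply/set0Pn; exists v; rewrite inE ve.
have cardE : (3 * #|Z| = 2%N * #|meeting S Z|)%N.
  have := sum_star S Z (fun _ _ => 1%N).
  under eq_bigr => v vZ do rewrite sum1_card deg3 //.
  under [in RHS]eq_bigr => e eZ do rewrite sum1_card trace2 //.
  by rewrite !sum_nat_const; lia.
(* Each member of M accounts for two incidences, while a vertex of Z lies in no member if it is in
   U, and in at most one otherwise. *)
have cardZ : (#|U| + 2 * #|M| <= #|Z|)%N.
  have mM : meeting M Z = M.
    apply/setP=> e; rewrite inE; case: (boolP (e \in M)) => //= eM.
    exact: trace_neq0 (subsetP MS _ eM).
  have sumM : (\sum_(v in Z) #|star M v| = 2%N * #|M|)%N.
    under eq_bigr do rewrite -sum1_card.
    rewrite (sum_star M Z (fun _ _ => 1%N)) mM.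
    under eq_bigr => e eM do rewrite sum1_card (trace2 (subsetP MS _ eM)).
    by rewrite sum_nat_const mulnC.
  rewrite -sumM (big_setID U) /= (setIidPr UZ) [X in (_ + (X + _))%N]big1; last first.
    move=> u uU; apply/eqP; rewrite cards_eq0 -subset0; apply/subsetP => m.
    by rewrite inE => /andP[mM' um]; have := UM _ _ uU mM'; rewrite um.
  rewrite -(cardsID U Z) (setIidPr UZ) add0n.
  rewrite leq_add2l -sum1_card; apply: leq_sum => v; rewrite inE => /andP[_ vZ].
  rewrite leqNgt; apply/negP => /card_gt1P[a [b []]].
  rewrite !inE => /andP[aM va] /andP[bM vb] ab.
  by have /setP/(_ v) := dM _ _ aM bM ab; rewrite !inE va vb vZ.
(* By [ext] no edge has both ends in U, so the three edges at each vertex of U are counted once. *)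
have cardU : (3 * #|U| <= #|meeting S U|)%N.
  have := sum_star S U (fun _ _ => 1%N).
  under eq_bigr => v vU do rewrite sum1_card deg3 ?(subsetP UZ) //.
  rewrite sum_nat_const mulnC => ->; rewrite -sum1_card; apply: leq_sum => e eU.
  rewrite sum1_card leqNgt; apply/negP => eU2.
  have eZ := meetU _ eU.
  have eq : e :&: U = e :&: Z by apply/eqP; rewrite eqEcard setIS // trace2.
  have [m mM /set0Pn[v]] := ext _ eZ.
  rewrite setIAC -eq !in_setI => /andP[/andP[_ vU] vm].
  by have := UM _ _ vU mM; rewrite vm.
pose I m := [set e in meeting S U | e :&: m :&: Z != set0].
have cardI m : m \in M -> (#|I m| <= 2)%N.
  move=> mM; have mZ := subsetP MS _ mM.
  have ImZ a : a \in I m -> a \in meeting S Z by rewrite inE => /andP[/meetU].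
  have tr a : a \in I m ->
      exists z u, [/\ z \in m :&: Z, u \in U & a :&: Z = [set z; u]].
    rewrite inE => /andP[aU /set0Pn[z]]; rewrite -setIA inE => /andP[za zm].
    have := aU; rewrite inE => /andP[_ /set0Pn[u]]; rewrite inE => /andP[ua uU].
    exists z, u; split=> //; apply/eqP; rewrite eq_sym eqEcard trace2 ?meetU //.
    have [zm' zZ] := setIP zm.
    rewrite subUset !sub1set !inE za ua zZ (subsetP UZ _ uU) /= cards2.
    by case: eqVneq => // zu; have := UM _ _ uU mM; rewrite -zu zm'.
  have inj a b : a \in I m -> b \in I m -> a :&: Z = b :&: Z -> a = b.
    move=> /ImZ aZ /ImZ bZ ab.
    by apply: (trace_inj2 bZ aZ); [rewrite trace2 | rewrite ab].
  (* If a and b joined different ends of m to different vertices of U, replacing m by a and b would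
     enlarge the matching. *)
  have aug a b z u z' u' : a \in I m -> b \in I m -> z \in m :&: Z -> z' \in m :&: Z ->
      u \in U -> u' \in U -> a :&: Z = [set z; u] -> b :&: Z = [set z'; u'] ->
      z != z' -> u = u'.
    move=> aI bI /setIP[zm zZ] /setIP[z'm z'Z] uU u'U az bz zz'.
    apply/eqP; apply: contraT => uu'.
    have [aZ bZ] := (ImZ _ aI, ImZ _ bI).
    have pMm : packing (M :\ m).
      apply/packingP; split; first by rewrite subDset subsetU ?MS ?orbT.
      by move=> e e' /setD1P[_ eM] /setD1P[_ e'M]; exact: dM.
    have hit c w v m' : c :&: Z = [set w; v] -> w \in m -> v \in U -> m' \in M :\ m ->
        c :&: m' :&: Z = set0.
      move=> cz wm vU /setD1P[m'm m'M]; rewrite setIAC cz; apply/setP=> t.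
      rewrite !inE; apply/negP => /andP[/orP[]/eqP-> tm'].
        have /setP/(_ w) := dM _ _ m'M mM m'm.
        have : w \in c :&: Z by rewrite cz set21.
        by rewrite !inE tm' wm => /andP[_ ->].
      by have := UM _ _ vU m'M; rewrite tm'.
    have [|pb bM] := packingU1 pMm bZ; first by move=> m'; exact: hit bz z'm u'U.
    have [|pa aM] := packingU1 pb aZ.
      move=> m' /setU1P[->|]; last exact: hit az zm uU.
      apply/setP=> t; rewrite !inE; apply/negP => /andP[/andP[ta tb] tZ].
      have : t \in a :&: Z by rewrite inE ta.
      have : t \in b :&: Z by rewrite inE tb.
      rewrite az bz !inE => /orP[]/eqP-> /orP[]/eqP e.
      - by rewrite e eqxx in zz'.
      - by have := UM _ _ uU mM; rewrite -e z'm.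
      - by have := UM _ _ u'U mM; rewrite e zm.
      - by rewrite e eqxx in uu'.
    have := maxM _ pa; by rewrite !cardsU1 aM bM (cardsD1 m M) mM !add1n ltnn.
  (* Together with m, three such edges would give z degree at least four. *)
  have star4 a b c z : a \in I m -> b \in I m -> c \in I m -> z \in m :&: Z ->
      z \in a -> z \in b -> z \in c -> a != b -> b != c -> c != a -> False.
    move=> aI bI cI /setIP[zm zZ] za zb zc ab bc ca.
    have nm e : e \in I m -> e != m.
      rewrite inE => /andP[]; rewrite inE => /andP[_ /set0Pn[u /setIP[ue uU]]] _.
      by apply: contraTneq ue => ->; exact: UM.
    have sS e : e \in I m -> z \in e -> e \in star S z.
      by move=> /ImZ; rewrite inE => /andP[eS _] ze; rewrite inE eS.
    have : (#|a |: (b |: (c |: [set m]))| <= #|star S z|)%N.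
      apply/subset_leq_card/subsetP => e; rewrite !inE => /or4P[]/eqP->.
      - by have := sS _ aI za; rewrite inE.
      - by have := sS _ bI zb; rewrite inE.
      - by have := sS _ cI zc; rewrite inE.
      - by rewrite zm andbT; move: mZ; rewrite inE => /andP[].
    by rewrite deg3 // !cardsU1 !inE !negb_or cards1 ab bc (eq_sym a c) ca !nm.
  rewrite leqNgt; apply/negP => /card_gt2P[a [b [c [[aI bI cI] [ab bc ca]]]]].
  have [za [ua [zaZ uaU az]]] := tr _ aI.
  have [zb [ub [zbZ ubU bz]]] := tr _ bI.
  have [zc [uc [zcZ ucU cz]]] := tr _ cI.
  have aab := aug _ _ _ _ _ _ aI bI zaZ zbZ uaU ubU az bz.
  have aac := aug _ _ _ _ _ _ aI cI zaZ zcZ uaU ucU az cz.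
  have abc := aug _ _ _ _ _ _ bI cI zbZ zcZ ubU ucU bz cz.
  have iab := inj _ _ aI bI; have iac := inj _ _ aI cI; have ibc := inj _ _ bI cI.
  have ia : za \in a by have : za \in a :&: Z; [rewrite az set21 | case/setIP].
  have ib : zb \in b by have : zb \in b :&: Z; [rewrite bz set21 | case/setIP].
  have ic : zc \in c by have : zc \in c :&: Z; [rewrite cz set21 | case/setIP].
  (* Three edges at the same end of m contradict [star4]. If two ends occur, [aug] identifies the
     three vertices in U, so the two edges sharing an end coincide by [inj]. Three distinct ends do
     not fit in the trace of m. *)
  have [eab|nab] := eqVneq za zb.
    have [eac|nac] := eqVneq za zc.
      by apply: (star4 a b c za); rewrite // ?eab // -?eab // eac.
    by move: ab; rewrite iab ?eqxx // az bz eab (aac nac) (abc _) // -eab.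
  have [eac|nac] := eqVneq za zc.
    by move: ca; rewrite iac ?eqxx // az cz eac (aab nab) (abc _) // -eac eq_sym.
  have [ebc|nbc] := eqVneq zb zc.
    by move: bc; rewrite ibc ?eqxx // bz cz ebc -(aab nab) (aac nac).
  have := trace2 mZ; apply/eqP; rewrite gtn_eqF //.
  by apply/card_gt2P; exists za, zb, zc; split=> //; split=> //; rewrite eq_sym.
have cardUM : (#|meeting S U| <= 2 * #|M|)%N.
  have sub : meeting S U \subset \bigcup_(m in M) I m.
    apply/subsetP => e eU; have [m mM em] := ext _ (meetU _ eU).
    by apply/bigcupP; exists m => //; rewrite inE eU.
  apply: leq_trans (subset_leq_card sub) _; apply: leq_trans (card_bigcup_leq _ _) _.
  by rewrite mulnC -sum_nat_const; exact: leq_sum.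
have cov : coverable S Z (#|M| + #|U|).
  apply: (@coverableS _ _ ((\bigcup_(m in M) m) :|: U) _ _ _ _ (leqnn _)).
    by apply/subsetP => v vZ; rewrite inE [v \in U]inE vZ andbT orbN.
  apply: coverableU.
    exists M; split=> //; apply/subsetP => m /(subsetP MS).
    by rewrite inE => /andP[].
  apply: coverable_card => v /(subsetP UZ) vZ.
  have : (0 < #|star S v|)%N by rewrite deg3.
  by rewrite card_gt0 => /set0Pn[e]; rewrite inE => /andP[eS ve]; exists e.
(* The left side is 5/2 |Z|, hence at least 5 |M| + 5/2 |U|, and 3 |U| <= 2 |M| makes this at least
   4 (|M| + |U|). *)
have := irr (subxx _) Z0 cov.
have -> : inside S Z Z = meeting S Z.
  by apply/setP=> e; rewrite inE subsetIr andbT.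
lia.
Qed.
End Cubic.

(* A case of the Chvatal-McDiarmid bound on transversals. *)
Lemma cubic_coverable (T : finType) (S : {set {set T}}) (Z : {set T}) :
  (forall v, v \in Z -> #|star S v| = 3%N) ->
  exists2 k, coverable S Z k & (4 * k <= #|Z| + #|meeting S Z|)%N.
Proof.
have [n] := ubnP #|Z|; elim: n Z => // n IH Z Zn deg3.
have [->|Z0] := eqVneq Z set0; first by exists 0; [exact: coverable0 | rewrite muln0].
(* If irreducibility fails at some Y, the induction hypothesis covers the rest. Degrees are counted
   in S, so deleting Y leaves those of the remaining vertices equal to 3. *)
apply: contrapT => notZ; apply: (no_irreducible_cubic deg3 Z0) => Y k YZ Y0 Yk.
rewrite ltnNge; apply/negP => le4k; apply: notZ.
have cY : (0 < #|Y|)%N by rewrite card_gt0.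
have cZ : #|Z| = (#|Y| + #|Z :\: Y|)%N by rewrite -(cardsID Y Z) (setIidPr YZ).
have [||l Zl le4l] := IH (Z :\: Y); first by lia.
  by move=> v; rewrite inE => /andP[_]; exact: deg3.
exists (k + l)%N; last by rewrite (card_meeting_setD S YZ); lia.
apply: coverableS (leqnn _) (coverableU Yk Zl).
by apply/subsetP => v vZ; rewrite !inE vZ andbT orbN.
Qed.

(** * Fractional covers of small support *)

(** A matrix with more rows than columns has a nonzero vector in its left kernel; [h] is that vector
    extended by zero outside A. *)
Lemma exists_dependency (F : fieldType) (I J : finType) (A : {set I}) (B : {set J})
    (m : I -> J -> F) : (#|B| < #|A|)%N ->
  exists h : I -> F, [/\ exists i, h i != 0, forall i, i \notin A -> h i = 0 &
    forall j, j \in B -> \sum_(i in A) h i * m i j = 0].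
Proof.
move=> BA; pose M := \matrix_(i < #|A|, j < #|B|) m (enum_val i) (enum_val j).
have /rowV0Pn[u] : kermx M != 0.
  by rewrite -mxrank_eq0 mxrank_ker -lt0n subn_gt0 (leq_ltn_trans (rank_leq_col M)).
move=> /sub_kermxP uM u0.
(* At most one index contributes, and none when x lies outside A, so the sum is the extension by
   zero. *)
pose h x := \sum_(i < #|A| | enum_val i == x) u 0 i.
have hE i : h (enum_val i) = u 0 i.
  by rewrite /h (big_pred1 i) // => j; rewrite (inj_eq enum_val_inj).
exists h; split.
- have /existsP[i ui] : [exists i, u 0 i != 0].
    apply: contraNT u0; rewrite negb_exists => /forallP u0.
    by apply/eqP/rowP => i; rewrite mxE; apply/eqP; have := u0 i; rewrite negbK.
  by exists (enum_val i); rewrite hE.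
- move=> i iA; apply: big1 => j /eqP ji; move: iA; rewrite -ji => /negP[].
  exact: enum_valP.
- move=> j jB; rewrite big_enum_val /=.
  have /rowP/(_ (enum_rank_in jB j)) := uM; rewrite !mxE => uM0.
  rewrite -[RHS]uM0.
  by apply: eq_bigr => i _; rewrite mxE hE enum_rankK_in.
Qed.

(** If the support has more edges than X has vertices, some nonzero combination of its edges
    vanishes at every vertex of X. Moving f along it preserves all vertex sums, until a weight of
    the support drops to zero. *)
Lemma fcover_small_support (R : realFieldType) (T : finType) (E : {set {set T}})
    (f : {set T} -> R) (X : {set T}) : fcover E f X ->
  exists2 g, fcover E g X &
    wt E g X X <= wt E f X X /\ (#|fsupp E g X| <= #|X|)%N.
Proof.
have [n] := ubnP #|fsupp E f X|; elim: n f => // n IH f fn fX.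
have [small|big] := leqP #|fsupp E f X| #|X|; first by exists f.
have [f0 f1] := fX.
suff [g gX [gf gn]] : exists2 g, fcover E g X &
    wt E g X X <= wt E f X X /\ (#|fsupp E g X| < #|fsupp E f X|)%N.
  have [|g' g'X [g'g g'n]] := IH g _ gX; first by rewrite (leq_trans gn).
  by exists g' => //; split=> //; exact: le_trans g'g gf.
have meetE e : e \in fsupp E f X -> e \in E.
  by rewrite inE => /andP[]; rewrite inE => /andP[].
have meetX e : e \in fsupp E f X -> exists2 v, v \in e & v \in X.
  rewrite inE => /andP[]; rewrite inE => /andP[_ /set0Pn[v /setIP[ve vX]]] _.
  by exists v.
have [h [[e0 he0] hS hX]] :=
  exists_dependency (fun (e : {set T}) v => (v \in e)%:R : R) big.
(* The negative of a dependency is one too, so the sign can be chosen not to increase the weight. *)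
wlog hsum : h he0 hS hX / \sum_(e in fsupp E f X) h e <= 0.
  have [hle|/ltW hge] := leP (\sum_(e in fsupp E f X) h e) 0; first by move=> /(_ h he0 hS hX hle).
  move=> /(_ (fun e => - h e)); apply; first by rewrite oppr_eq0.
  - by move=> e /hS ->; rewrite oppr0.
  - move=> v /hX hv; under eq_bigr do rewrite mulNr.
    by rewrite sumrN hv oppr0.
  - by rewrite sumrN oppr_le0.
have hstar v : v \in X -> \sum_(e in star E v) h e = 0.
  move=> vX; rewrite -[RHS](hX v vX) big_mkcond [RHS]big_mkcond; apply: eq_bigr => e _.
  rewrite inE; have [eS|/hS->] := boolP (e \in fsupp E f X); last by rewrite if_same.
  by rewrite (meetE _ eS) /=; case: ifP; rewrite ?mulr1 ?mulr0.
(* If [h] were nonnegative, its zero sum at a vertex of X on [e0] would force [h e0] to vanish. *)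
have [e1 e1S he1] : exists2 e, e \in fsupp E f X & h e < 0.
  apply/exists_inP; apply: contraNT he0; rewrite negb_exists_in => /forall_inP hge0.
  have hge e : 0 <= h e.
    have [eS|/hS->//] := boolP (e \in fsupp E f X).
    by have := hge0 e eS; rewrite -leNgt.
  have [eS|/hS->//] := boolP (e0 \in fsupp E f X).
  have [v ve vX] := meetX _ eS.
  have := hstar v vX; move/eqP; rewrite psumr_eq0; last by move=> e _.
  by move=> /allP/(_ e0); rewrite mem_index_enum inE (meetE _ eS) ve => /(_ isT).
pose P e := (e \in fsupp E f X) && (h e < 0).
have Pe1 : P e1 by rewrite /P e1S.
(* The least ratio is the longest step that keeps all weights nonnegative; it brings the weight of
   [e2] to zero. *)
case: (arg_minP (fun e => f e / - h e) Pe1) => e2 /andP[e2S he2] min2.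
pose t := f e2 / - h e2.
have fS e : e \in fsupp E f X -> 0 < f e by rewrite inE => /andP[].
have t0 : 0 <= t by rewrite divr_ge0 ?ltW ?fS // oppr_gt0.
pose g e := f e + t * h e.
have gsum (Q : pred {set T}) :
    \sum_(e | Q e) g e = \sum_(e | Q e) f e + t * \sum_(e | Q e) h e.
  by rewrite big_split /= mulr_sumr.
have g0 e : e \in E -> 0 <= g e.
  move=> eE; have [he|he] := leP 0 (h e); first by rewrite /g addr_ge0 ?f0 // mulr_ge0.
  have eS : e \in fsupp E f X.
    by apply: contraTT he => /hS->; rewrite ltxx.
  have := min2 e; rewrite /P eS he -/t => /(_ isT).
  by rewrite ler_pdivlMr ?oppr_gt0 // mulrN lerNl -subr_ge0 opprK addrC.
exists g; first by split=> // v vX; rewrite gsum hstar // mulr0 addr0 f1.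
split.
  rewrite /wt gsum gerDl; apply: mulr_ge0_le0 => //.
  rewrite (_ : \sum_(e | _) h e = \sum_(e in fsupp E f X) h e) //.
  rewrite big_mkcond [RHS]big_mkcond; apply: eq_bigr => e _.
  rewrite subsetIr andbT; have [|/hS->] := boolP (e \in fsupp E f X).
    by rewrite inE => /andP[->].
  by rewrite if_same.
apply: proper_card; apply/properP; split.
  apply/subsetP => e; rewrite inE => /andP[eX ge]; apply: contraTT ge => eS.
  rewrite /g (hS _ eS) mulr0 addr0; move: eS; rewrite inE eX /=.
exact: id.
exists e2 => //; rewrite inE /g /t invrN mulrN mulNr -mulrA mulVf ?mulr1 ?subrr ?ltxx ?andbF //.
by rewrite lt_eqF.
Qed.

(** * Irreducible fractional covers *)

Section Irreducible.
Variables (R : realFieldType) (T : finType) (E : {set {set T}}).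
Variables (f : {set T} -> R) (X : {set T}).
Hypothesis rank3 : forall e, e \in E -> (#|e| <= 3)%N.
Hypothesis fX : fcover E f X.
Hypothesis X0 : X != set0.
Local Notation S := (fsupp E f X).
Hypothesis smallS : (#|S| <= #|X|)%N.
Hypothesis irr : forall (Y : {set T}) (k : nat), Y \subset X -> Y != set0 ->
  coverable E Y k -> wt E f X Y + #|Y|%:R / 6 < k%:R.

Let SE e : e \in S -> e \in E.
Proof. by rewrite inE => /andP[]; rewrite inE => /andP[]. Qed.

Let Spos e : e \in S -> 0 < f e.
Proof. by rewrite inE => /andP[]. Qed.

Let meetS : meeting S X = S.
Proof.
apply/setP=> e; rewrite inE; case: (boolP (e \in S)) => //=.
by rewrite inE => /andP[]; rewrite inE => /andP[].
Qed.

Let trace_gt0 e : e \in S -> (0 < #|e :&: X|)%N.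
Proof. by rewrite -meetS card_gt0; exact: trace_neq0. Qed.

Let trace_le3 e : e \in S -> (#|e :&: X| <= 3)%N.
Proof. by move=> /SE/rank3; apply: leq_trans; rewrite subset_leq_card ?subsetIl. Qed.

Let starP v e : reflect (e \in S /\ v \in e) (e \in star S v).
Proof. exact: setIdP. Qed.

Let sumS v : v \in X -> 1 <= \sum_(e in star S v) f e.
Proof.
move=> vX; have [f0 /(_ v vX)/le_trans] := fX; apply.
rewrite big_mkcond [leRHS]big_mkcond; apply: ler_sum => e _.
rewrite !inE; have [eE|//] := boolP (e \in E).
have [ve|_] /= := boolP (v \in e); last by rewrite andbF.
rewrite (_ : e :&: X != set0) ?andbT /=; last by apply/set0Pn; exists v; rewrite inE ve.
by case: ltP => // ->.
Qed.

(** The form in which [irr] is applied: as weights are nonnegative, it suffices to name some of the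
    edges with trace in Y. *)
Let irr_sum (A : {set {set T}}) (Y : {set T}) (k : nat) : A \subset S ->
  (forall e, e \in A -> e :&: X \subset Y) -> Y \subset X -> Y != set0 -> coverable E Y k ->
  \sum_(e in A) f e + #|Y|%:R / 6 < k%:R.
Proof.
move=> AS AY YX Y0 Yk; apply: le_lt_trans (irr YX Y0 Yk); rewrite lerD2r.
rewrite /wt big_mkcond [leRHS]big_mkcond; apply: ler_sum => e _.
case: ifP => [eA|_].
  have eS := subsetP AS _ eA; rewrite AY // andbT.
  by move: eS; rewrite inE => /andP[->].
case: ifP => // /andP[+ _]; rewrite inE => /andP[eE _].
by have [f0 _] := fX; exact: f0.
Qed.

Let cov1 e : e \in S -> coverable E (e :&: X) 1.
Proof. by move=> eS; apply: coverable1 (SE eS) _; rewrite subsetIl. Qed.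

Let f_lt e : e \in S -> f e + #|e :&: X|%:R / 6 < 1.
Proof.
move=> eS; have := @irr_sum [set e] (e :&: X) 1; rewrite big_set1; apply.
- by rewrite sub1set.
- by move=> e'; rewrite inE => /eqP->.
- exact: subsetIr.
- by rewrite -card_gt0 trace_gt0.
- exact: cov1.
Qed.

(** Otherwise the trace of e, covered by one edge, would carry weight at least 1. *)
Let trace_nsub e e' : e \in S -> e' \in S -> e != e' -> 1 <= f e + f e' ->
  ~~ (e' :&: X \subset e :&: X).
Proof.
move=> eS e'S ne sum1; apply/negP => sub.
have := @irr_sum [set e; e'] (e :&: X) 1.
rewrite big_setU1 ?inE //= big_set1 => H.
suff : f e + f e' + #|e :&: X|%:R / 6 < 1.
  by have : 0 <= #|e :&: X|%:R :> R by []; lra.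
apply: H.
- by rewrite subUset !sub1set eS.
- by move=> a; rewrite !inE => /orP[]/eqP->.
- exact: subsetIr.
- by rewrite -card_gt0 trace_gt0.
- exact: cov1.
Qed.

Let deg_ge2 v : v \in X -> (1 < #|star S v|)%N.
Proof.
move=> vX; have sum1 := sumS vX; rewrite ltnNge leq_eqVlt ltnS leqn0; apply/negP => /orP[].
  move=> /cards1P[e se]; move: sum1; rewrite se big_set1.
  have /starP[eS _] : e \in star S v by rewrite se set11.
  have := f_lt eS; have : 0 <= #|e :&: X|%:R :> R by [].
  lra.
by rewrite cards_eq0 => /eqP se; move: sum1; rewrite se big_set0; lra.
Qed.

(* If y had at most three edges, some Y made of the three vertices of A, of y and of the
   trace of at most one more edge at y would have wt + |Y|/6 >= 2. *)
Let pendant_deg x y e A : x \in X -> star S x = [set e; A] -> e != A ->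
  #|e :&: X| = 2%N -> #|A :&: X| = 3%N -> y \in e :&: X -> y != x -> (3 < #|star S y|)%N.
Proof.
move=> xX sx eA e2 A3 ye yx.
have /starP[eS xe] : e \in star S x by rewrite sx set21.
have /starP[AS xA] : A \in star S x by rewrite sx set22.
have := sumS xX; rewrite sx big_setU1 ?inE //= big_set1 => sumx.
have := f_lt eS; have := f_lt AS; rewrite e2 A3 => fA fe.
have eX : e :&: X = [set x; y].
  apply/eqP; rewrite eq_sym eqEcard e2 subUset !sub1set ye inE xe xX /= cards2.
  by rewrite eq_sym yx.
have [ye' yX] := setIP ye.
have yA : y \notin A.
  apply/negP => yA; have := trace_nsub AS eS; rewrite eq_sym eA addrC => /(_ isT sumx).
  by rewrite eX subUset !sub1set !inE xA xX yA yX.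
pose Y0 := y |: A :&: X.
have Y0X : Y0 \subset X by rewrite subUset sub1set yX subsetIr.
have Y04 : #|Y0| = 4%N by rewrite cardsU1 A3 inE (negPf yA).
have eY0 : e :&: X \subset Y0 by rewrite eX subUset !sub1set !inE eqxx xA xX orbT.
pose D := star S y :\ e.
have DS B : B \in D -> [/\ B \in S, B != e, B != A & y \in B].
  move=> /setD1P[Be /starP[BS yB]]; split=> //.
  by apply: contraTneq yB => ->.
have sumD : 1 <= f e + \sum_(B in D) f B.
  have := sumS yX; rewrite (big_setD1 e) //.
  exact/starP.
(* Two edges, A and B, cover Y because B contains y, and the trace of e lies in [Y0]. *)
have irrD (D' : {set {set T}}) Y B : D' \subset D -> B \in S -> Y = Y0 :|: B :&: X ->
    y \in B -> (forall C, C \in D' -> C :&: X \subset Y) ->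
    f e + f A + \sum_(C in D') f C + #|Y|%:R / 6 < 2%:R.
  move=> D'D BS YE yB D'Y.
  have AD' : A \notin D'.
    by apply/negP => /(subsetP D'D)/DS[_ _]; rewrite eqxx.
  have eD' : e \notin A |: D'.
    rewrite !inE negb_or eA; apply/negP => /(subsetP D'D)/DS[_].
    by rewrite eqxx.
  rewrite -[f e + f A + _]addrA -(big_setU1 _ AD') -(big_setU1 _ eD') /=; apply: irr_sum.
  - rewrite !subUset !sub1set eS AS; apply/subsetP => C /(subsetP D'D)/DS[CS _ _ _].
    exact: CS.
  - move=> C /setU1P[->|/setU1P[->|/D'Y//]].
      by rewrite YE subsetU // eY0.
    by rewrite YE -setUA subsetU // orbC subsetU // subxx.
  - by rewrite YE subUset Y0X subsetIr.
  - by rewrite -card_gt0 YE (leq_trans _ (subset_leq_card (subsetUl _ _))) // Y04.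
  - apply: coverableS (leqnn _) (coverableU (cov1 AS) (cov1 BS)).
    rewrite YE /Y0 !subUset sub1set subsetUl subsetUr !inE yB yX orbT.
    by [].
pose D0 := [set B in D | B :&: X \subset Y0].
have D0D : D0 \subset D by apply/subsetP => B; rewrite inE => /andP[].
(* As f(e) + f(A) >= 1, the four vertices of [Y0] leave less than 2 - 1 - 4/6. *)
have sumD0 : \sum_(B in D0) f B < 1 / 3.
  have Y0E : Y0 = Y0 :|: e :&: X by rewrite (setUidPl eY0).
  have D0Y C : C \in D0 -> C :&: X \subset Y0 by rewrite inE => /andP[].
  by have := irrD D0 Y0 e D0D eS Y0E ye' D0Y; rewrite Y04; lra.
(* An edge outside [D0] brings a fifth vertex, so the slack shrinks to 2 - 1 - 5/6. *)
have D1lt B : B \in D :\: D0 -> f B + \sum_(C in D0) f C < 1 / 6.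
  move=> /setDP[BD BD0]; have [BS Be BA yB] := DS _ BD.
  rewrite -big_setU1 //=.
  have BD0D : B |: D0 \subset D by rewrite subUset sub1set BD D0D.
  have BD0Y C : C \in B |: D0 -> C :&: X \subset Y0 :|: B :&: X.
    move=> /setU1P[->|]; first by rewrite subsetUr.
    by rewrite inE => /andP[_ CY]; rewrite subsetU // CY.
  have := irrD (B |: D0) (Y0 :|: B :&: X) B BD0D BS erefl yB BD0Y.
  have : (#|Y0| < #|Y0 :|: B :&: X|)%N.
    apply: proper_card; rewrite properEneq subsetUl andbT eq_sym.
    by move: BD0; rewrite inE BD /=; apply: contraNneq => <-; rewrite subsetUr.
  rewrite Y04 -(ler_nat R); lra.
rewrite ltnNge; apply/negP => deg3.
have D2 : (#|D| <= 2)%N.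
  have ey : e \in star S y by exact/starP.
  by move: deg3; rewrite (cardsD1 e (star S y)) ey.
have := sumD; rewrite (big_setID D0) /= (setIidPr D0D) => sumD'.
(* Since f(e) < 2/3, the edges of [D] must carry more than 1/3. Either all lie in [D0], of weight
   below 1/3, or one outside together with [D0] has less than 1/6 and at most one further edge adds
   at most 1/6. *)
have [D1|/set0Pn[B BD1]] := eqVneq (D :\: D0) set0.
  by move: sumD'; rewrite D1 big_set0; lra.
have := D1lt _ BD1; move: sumD'; rewrite [X in _ + (_ + X)](big_setD1 B BD1) /=.
suff : \sum_(C in (D :\: D0) :\ B) f C <= 1 / 6 by lra.
apply: (@le_trans _ _ (\sum_(C in (D :\: D0) :\ B) 1 / 6)).
  apply: ler_sum => C /setD1P[_ /D1lt].
  suff : 0 <= \sum_(C in D0) f C by lra.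
  by apply: sumr_ge0 => C' /(subsetP D0D)/DS[/Spos/ltW].
rewrite sumr_const -mulr_natl.
have : (#|(D :\: D0) :\ B| <= 1)%N.
  have : (#|D :\: D0| <= 2)%N by rewrite (leq_trans (subset_leq_card (subsetDl _ _))).
  by rewrite (cardsD1 B) BD1.
rewrite -(ler_nat R); lra.
Qed.

(** These are the vertices that an even split of charges would leave short, with 1/2 + 1/3 < 1. *)
Definition pendant v := [&& v \in X, #|star S v| == 2%N, [exists e in star S v, #|e :&: X| == 2%N] &
  [exists A in star S v, #|A :&: X| == 3%N]].

Let pendant_nbr x e y : pendant x -> e \in star S x -> #|e :&: X| = 2%N ->
  y \in e :&: X -> y != x -> (3 < #|star S y|)%N.
Proof.
move=> /and4P[xX s2 _ /exists_inP[A Ax /eqP A3]] ex e2.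
have eA : e != A by apply: contra_eq_neq e2 => ->; rewrite A3.
apply: pendant_deg (xX) _ (eA) (e2) (A3).
by apply/eqP; rewrite eq_sym eqEcard subUset !sub1set ex Ax (eqP s2) cards2 eA.
Qed.

(* The support has at most |X| edges and each of them shares out a charge of at most 1,
   while every vertex receives at least 1; hence every vertex receives exactly 1.  A pair
   favours its pendant vertex, which the other end, of degree at least 4, can afford. *)
Definition share (e : {set T}) (v : T) : R :=
  if #|e :&: X| == 1%N then 1
  else if #|e :&: X| == 2%N then
    if pendant v then 2 / 3 else if [exists u in e :&: X, pendant u] then 1 / 3 else 1 / 2
  else 1 / 3.

Let share_ge e v : 1 / 3 <= share e v.
Proof. by rewrite /share; do !case: ifP => _; lra. Qed.

(** The ends of a pair are not both pendant, since the neighbour of a pendant vertex has degree at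
    least 4. Hence a pair gives 2/3 + 1/3 or 1/2 + 1/2. *)
Let sum_share e : e \in S -> \sum_(v in e :&: X) share e v <= 1.
Proof.
move=> eS; have := trace_gt0 eS; have := trace_le3 eS.
have [e1 _ _|e1] := eqVneq #|e :&: X| 1%N.
  by under eq_bigr do rewrite /share e1 eqxx; rewrite sumr_const e1 mulr1n.
have [e2 _ _|e2 e3 e0] := eqVneq #|e :&: X| 2%N; last first.
  under eq_bigr do rewrite /share (negPf e1) (negPf e2).
  rewrite sumr_const -mulr_natl; have -> : #|e :&: X| = 3%N by lia.
  lra.
under eq_bigr do rewrite /share e2 /=.
have nbr x y : x \in e :&: X -> y \in e :&: X -> y != x -> pendant x -> ~~ pendant y.
  move=> /setIP[xe xX] ye yx ptx.
  apply/negP => /and4P[_ /eqP y2 _ _].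
  by have := pendant_nbr ptx _ e2 ye yx; rewrite y2 => /(_ _)/negP; apply => //; exact/starP.
have [/exists_inP[x xe ptx]|/negPf none] := boolP [exists u in e :&: X, pendant u].
  rewrite (big_setD1 x) //= ptx (eq_bigr (fun=> 1 / 3)); last first.
    by move=> y /setD1P[yx ye]; rewrite (negPf (nbr x y _ _ _ _)).
  have -> : \sum_(y in (e :&: X) :\ x) (1 / 3 : R) = 1 / 3; last by lra.
  have : #|(e :&: X) :\ x| = 1%N by move: e2; rewrite (cardsD1 x) xe => -[].
  by rewrite sumr_const => ->; rewrite mulr1n.
rewrite (eq_bigr (fun=> 1 / 2)); last first.
  move=> y ye; case: ifP => // pty.
  suff : [exists u in e :&: X, pendant u] by rewrite none.
  by apply/exists_inP; exists y.
by rewrite sumr_const e2 -mulr_natl; lra.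
Qed.

Definition charge v := \sum_(e in star S v) share e v.

Let charge_deg v : #|star S v|%:R / 3 <= charge v.
Proof.
rewrite /charge mulrC mulr_natr -sumr_const; apply: ler_sum => e _.
by have := share_ge e v; lra.
Qed.

(** Three shares of at least 1/3 suffice. At degree 2, [f_lt] excludes two traces of size 3. A
    singleton trace gives 1 by itself, a pendant vertex gets 2/3 + 1/3, and otherwise both traces
    are pairs. *)
Let charge_ge1 v : v \in X -> 1 <= charge v.
Proof.
move=> vX; have := deg_ge2 vX; have := charge_deg v.
have [d3 + _|d3] := leqP 3 #|star S v|.
  by move: d3; rewrite -(ler_nat R); lra.
move=> _ d2; have {d2 d3} d2 : #|star S v| = 2%N by lia.
have /cards2P[a [b [ab sv]]] : #|star S v| == 2%N by rewrite d2.
have := sumS vX; rewrite /charge sv !big_setU1 ?inE //= !big_set1.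
have av : a \in star S v by rewrite sv set21.
have bv : b \in star S v by rewrite sv set22.
have [/starP[aS va] /starP[bS vb]] := (av, bv).
have := f_lt aS; have := f_lt bS => fb fa sab.
have lt6 : (#|a :&: X| + #|b :&: X| < 6)%N.
  by rewrite -(ltr_nat R) natrD; lra.
have [a1|na1] := eqVneq #|a :&: X| 1%N.
  by have := share_ge b v; rewrite [share a v]/share a1 /=; lra.
have [b1|nb1] := eqVneq #|b :&: X| 1%N.
  by have := share_ge a v; rewrite [share b v]/share b1 /=; lra.
have [ptv|nptv] := boolP (pendant v).
  have [a2|na2] := eqVneq #|a :&: X| 2%N.
    by have := share_ge b v; rewrite [share a v]/share a2 ptv /=; lra.
  have [b2|nb2] := eqVneq #|b :&: X| 2%N.
    by have := share_ge a v; rewrite [share b v]/share b2 ptv /=; lra.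
  exfalso; move: (trace_gt0 aS) (trace_gt0 bS) na1 nb1 na2 nb2 lt6.
  by move: #|a :&: X| #|b :&: X| => i j; clear; lia.
(* Having degree 2, v is not the neighbour of a pendant vertex, so the pair splits evenly. *)
have half e : e \in star S v -> #|e :&: X| = 2%N -> share e v = 1 / 2.
  move=> ev e2; rewrite /share e2 /= (negPf nptv); case: ifP => // /exists_inP[u ue ptu].
  have /starP[eS ve] := ev; have [ue' uX] := setIP ue.
  have vu : v != u by apply: contraNneq nptv => ->.
  have := pendant_nbr ptu _ e2 _ vu; rewrite d2 => H.
  by have := H (introT (starP _ _) (conj eS ue')) (introT setIP (conj ve vX)).
have np : ~~ [&& #|a :&: X| == 2%N & #|b :&: X| == 3%N].
  apply: contraNN nptv => /andP[a2 b3]; rewrite /pendant vX d2 eqxx /=.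
  by apply/andP; split; apply/exists_inP; [exists a | exists b].
have np' : ~~ [&& #|b :&: X| == 2%N & #|a :&: X| == 3%N].
  apply: contraNN nptv => /andP[b2 a3]; rewrite /pendant vX d2 eqxx /=.
  by apply/andP; split; apply/exists_inP; [exists b | exists a].
have [a2 b2] : #|a :&: X| = 2%N /\ #|b :&: X| = 2%N.
  move: (trace_gt0 aS) (trace_gt0 bS) (trace_le3 aS) (trace_le3 bS) na1 nb1 np np' lt6.
  by move: #|a :&: X| #|b :&: X| => i j; clear; lia.
by rewrite !half //; lra.
Qed.

Let charge1 v : v \in X -> charge v = 1.
Proof.
have : \sum_(u in X) (charge u - 1) <= 0.
  rewrite sumrB sumr_const /charge (sum_star S X share) meetS subr_le0.
  apply: (@le_trans _ _ #|S|%:R); last by rewrite ler_nat.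
  by rewrite -sumr_const; apply: ler_sum => e; exact: sum_share.
have ge0 u : u \in X -> 0 <= charge u - 1 by move=> uX; rewrite subr_ge0 charge_ge1.
move=> le0 vX; apply/eqP; rewrite -subr_eq0; apply/eqP.
have /eqP : \sum_(u in X) (charge u - 1) = 0 by apply/le_anti; rewrite le0 sumr_ge0.
by rewrite psumr_eq0 // => /allP/(_ v); rewrite mem_index_enum vX => /(_ isT)/eqP.
Qed.

Let deg_le3 v : v \in X -> (#|star S v| <= 3)%N.
Proof.
move=> vX; have := charge_deg v; rewrite charge1 // -(ler_nat R); lra.
Qed.

(** The partner of a pendant vertex in its pair would have degree at least 4, against [deg_le3]. *)
Let no_pendant v : pendant v = false.
Proof.
apply/negP => ptv; have /and4P[vX _ /exists_inP[e ev /eqP e2] _] := ptv.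
have /starP[eS ve] := ev.
have : (0 < #|(e :&: X) :\ v|)%N by move: e2; rewrite (cardsD1 v) inE ve vX add1n => -[->].
rewrite card_gt0 => /set0Pn[y /setD1P[yv ye]].
have := pendant_nbr ptv ev e2 ye yv; rewrite ltnNge deg_le3 //.
by have /setIP[] := ye.
Qed.

(** * Excluding traces of size two *)

Let shareE e v : e \in S -> share e v = #|e :&: X|%:R^-1.
Proof.
move=> eS; have := trace_gt0 eS; have := trace_le3 eS.
rewrite /share no_pendant; have -> : [exists u in e :&: X, pendant u] = false.
  by apply: negbTE; rewrite negb_exists_in; apply/forall_inP => u _; rewrite no_pendant.
by case: #|e :&: X| => [|[|[|[|n]]]] //= _ _; rewrite ?invr1 ?div1r.
Qed.

(** The other edges at v must supply exactly 1/2. Each gives at least 1/3, so there is only one, and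
    its trace is a pair. *)
Let pair_star v e : v \in X -> e \in star S v -> #|e :&: X| = 2%N ->
  exists e', [/\ e' != e, star S v = [set e; e'] & #|e' :&: X| = 2%N].
Proof.
move=> vX ev e2; have := charge1 vX; rewrite /charge (big_setD1 e) //=.
have /starP[eS ve] := ev; rewrite shareE // e2 => sum1.
pose D := star S v :\ e.
have sumD : \sum_(e' in D) share e' v = 1 / 2 by rewrite /D; lra.
have D1 : (#|D| <= 1)%N.
  rewrite leqNgt; apply/negP => D2.
  suff : #|D|%:R / 3 <= \sum_(e' in D) share e' v.
    by move: D2; rewrite sumD -(ler_nat R); lra.
  rewrite mulrC mulr_natr -sumr_const; apply: ler_sum => e' _.
  by have := share_ge e' v; lra.
have D0 : D != set0 by apply: contra_eqN sumD => /eqP->; rewrite big_set0; apply/eqP; lra.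
have /cards1P[e' De'] : #|D| == 1%N by rewrite eqn_leq D1 card_gt0.
have : e' \in D by rewrite De' set11.
move=> /setD1P[e'e /starP[e'S ve']]; exists e'; split=> //.
  by rewrite -(setD1K ev) -/D De'.
move: sumD; rewrite De' big_set1 shareE //.
have := trace_gt0 e'S; have := trace_le3 e'S.
case: #|e' :&: X| => [|[|[|[|n]]]] // _ _ h.
  by have : (0 : R) < 0; [lra | rewrite ltxx].
by have : (0 : R) < 0; [lra | rewrite ltxx].
Qed.

(** By [pair_star], e = vy continues to pairs a = vw and b = yz, forming a path or, if w = z, a
    triangle. Two edges, a and b, cover all its vertices, and the three weights are then too large
    for [irr_sum]. *)
Let no_pair e : e \in S -> #|e :&: X| != 2%N.
Proof.
move=> eS; apply/eqP => e2.
have /eqP/cards2P[v [y [vy eX]]] := e2.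
have /setIP[ve vX] : v \in e :&: X by rewrite eX set21.
have /setIP[ye yX] : y \in e :&: X by rewrite eX set22.
have ev : e \in star S v by exact/starP.
have ey : e \in star S y by exact/starP.
have [a [ae sv a2]] := pair_star vX ev e2.
have [b [be sy b2]] := pair_star yX ey e2.
have /starP[aS va] : a \in star S v by rewrite sv set22.
have /starP[bS yb] : b \in star S y by rewrite sy set22.
have := sumS vX; rewrite sv big_setU1 ?inE 1?eq_sym //= big_set1 => fea.
have := sumS yX; rewrite sy big_setU1 ?inE 1?eq_sym //= big_set1 => feb.
have := f_lt eS; rewrite e2 => fe.
have other c u : c \in S -> c != e -> #|c :&: X| = 2%N -> u \in c :&: X -> u \in e :&: X ->
    1 <= f e + f c -> exists2 w, c :&: X = [set u; w] & w \notin e :&: X.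
  move=> cS ce c2 uc ue fec.
  have /cards1P[w cw] : #|(c :&: X) :\ u| == 1%N by move: c2; rewrite (cardsD1 u) uc add1n => -[->].
  have cE : c :&: X = [set u; w] by rewrite -(setD1K uc) cw.
  exists w => //; apply: contraTN (trace_nsub eS cS _ fec) => [we|]; last by rewrite eq_sym.
  by rewrite negbK cE subUset !sub1set ue we.
have [||w aX we] := other a v aS ae a2 _ _ fea; try by rewrite inE ?va ?ve vX.
have [||z bX ze] := other b y bS be b2 _ _ feb; try by rewrite inE ?yb ?ye yX.
have wa : w \in a :&: X by rewrite aX set22.
have zb : z \in b :&: X by rewrite bX set22.
have [[wa' wX] [zb' zX]] := (setIP wa, setIP zb).
have ab : a != b.
  apply: contraNneq we => ab; move: (yb); rewrite -ab => ya.
  have : y \in a :&: X by rewrite inE ya.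
  by rewrite aX !inE eq_sym (negPf vy) => /eqP <-; rewrite ye.
have sub3 : [set e; a; b] \subset S by rewrite !subUset !sub1set eS aS bS.
pose Y := a :&: X :|: b :&: X.
have YX : Y \subset X by rewrite subUset !subsetIr.
have Y0 : Y != set0 by apply/set0Pn; exists w; rewrite inE wa.
have in3 c : c \in [set e; a; b] -> c :&: X \subset Y.
  rewrite !inE => /orP[/orP[]|] /eqP->; rewrite ?subsetUl ?subsetUr //.
  by rewrite eX subUset !sub1set !inE va vX yb yX orbT.
have := irr_sum sub3 in3 YX Y0 (coverableU (cov1 aS) (cov1 bS)).
rewrite -setUA !big_setU1 ?inE ?negb_or 1?eq_sym ?ae 1?eq_sym ?be //= big_set1.
have YE : Y = v |: (y |: [set w; z]).
  rewrite /Y aX bX; apply/setP => t; rewrite !inE.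
  by case: (t == v) (t == w) (t == y) (t == z) => [] [] [] [].
move: we ze; rewrite eX !inE !negb_or => /andP[wv wy] /andP[zv zy].
have cY : #|Y| = (#|[set w; z]|.+2)%N.
  by rewrite YE !cardsU1 !inE !negb_or vy !(eq_sym _ w) !(eq_sym _ z) wv zv wy zy.
(* On a path, the weight is at least 2 - f(e) > 4/3, and 4/3 + 4/6 = 2. In a triangle, the
   constraint at w adds f(a) + f(b) >= 1, so the weight is at least 3/2, and 3/2 + 3/6 = 2. *)
rewrite cY cards2; have [wz|wz] /= := eqVneq w z; last by lra.
have aw : a \in star S w by exact/starP.
have bw : b \in star S w by apply/starP; rewrite wz.
have [c [ca sw _]] := pair_star wX aw a2.
have cb : c = b.
  by move: bw; rewrite sw !inE eq_sym (negPf ab) => /eqP.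
have := sumS wX; rewrite sw cb big_setU1 ?inE //= big_set1.
lra.
Qed.

Lemma no_irreducible_fcover : False.
Proof.
have trace3 e : e \in S -> #|e :&: X| = 3%N.
  move=> eS; have := trace_gt0 eS; have := trace_le3 eS; have := no_pair eS.
  case e1 : #|e :&: X| => [|[|[|[|n]]]] //= _ _ _.
  have /eqP/cards1P[v ev] := e1.
  have /setIP[ve vX] : v \in e :&: X by rewrite ev set11.
  have evS : e \in star S v by exact/starP.
  suff : (0 : R) < 0 by rewrite ltxx.
  (* A singleton trace already gives v a charge of 1, and a second edge at v would exceed it. *)
  have := charge1 vX; rewrite /charge (big_setD1 e) //= shareE // e1 invr1.
  have := deg_ge2 vX; rewrite (cardsD1 e) evS ltnS card_gt0 => /set0Pn[e' e'D].
  rewrite (big_setD1 e') //=; have := share_ge e' v.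
  suff : 0 <= \sum_(i in (star S v :\ e) :\ e') share i v by lra.
  by apply: sumr_ge0 => i _; have := share_ge i v; lra.
have deg3 v : v \in X -> #|star S v| = 3%N.
  move=> vX; have := charge1 vX; rewrite /charge.
  rewrite (eq_bigr (fun=> 3%:R^-1)); last by move=> e /starP[eS _]; rewrite shareE ?trace3.
  rewrite sumr_const -mulr_natl => d; apply/eqP; rewrite -(eqr_nat R); apply/eqP; lra.
have [k Xk] := cubic_coverable deg3; rewrite meetS => le4k.
have EXk : coverable E X k.
  have [C [CS XC Ck]] := Xk; exists C; split=> //.
  by apply/subsetP => e /(subsetP CS)/SE.
(* Here [smallS] turns 4k <= |X| + |S| into a bound by 2 |X|. *)
have le2k : (2 * k <= #|X|)%N by lia.
have traceX e : e \in S -> e :&: X \subset X by rewrite subsetIr.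
have := irr_sum (subxx S) traceX (subxx X) X0 EXk.
have sumE : \sum_(v in X) \sum_(e in star S v) f e = 3%:R * \sum_(e in S) f e.
  rewrite (sum_star S X (fun e _ => f e)) meetS mulr_sumr; apply: eq_bigr => e eS.
  by rewrite sumr_const trace3 // mulr_natl.
have : #|X|%:R <= 3%:R * \sum_(e in S) f e.
  rewrite -sumE -sumr_const; apply: ler_sum => v vX; exact: sumS.
by move: le2k; rewrite -(ler_nat R) natrM; lra.
Qed.
End Irreducible.

(** * From fractional covers to the ratio bound *)

Lemma fcover_coverable (R : realFieldType) (T : finType) (E : {set {set T}})
    (f : {set T} -> R) (X : {set T}) :
  (forall e, e \in E -> (#|e| <= 3)%N) -> fcover E f X ->
  exists2 k, coverable E X k & k%:R <= wt E f X X + #|X|%:R / 6.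
Proof.
move=> rank3; have [n] := ubnP #|X|; elim: n f X => // n IH f X Xn fX.
have [->|X0] := eqVneq X set0.
  exists 0%N; first exact: coverable0.
  rewrite cards0 mul0r addr0; apply: sumr_ge0 => e /andP[]; rewrite inE => /andP[eE _] _.
  by have [f0 _] := fX; exact: f0.
have [g gX [gf gsmall]] := fcover_small_support fX.
suff [k Xk kle] : exists2 k, coverable E X k & k%:R <= wt E g X X + #|X|%:R / 6.
  by exists k => //; lra.
(* If irreducibility fails at Y, induction applies to the same g on the rest. Its support may be too
   large for the smaller set, so the induction hypothesis asks nothing of it and the reduction is
   repeated at each stage. *)
apply: contrapT => notX; apply: (no_irreducible_fcover rank3 gX X0 gsmall) => Y k YX Y0 Yk.
rewrite ltNge; apply/negP => lek; apply: notX.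
have cY : (0 < #|Y|)%N by rewrite card_gt0.
have cX : #|X| = (#|Y| + #|X :\: Y|)%N by rewrite -(cardsID Y X) (setIidPr YX).
have [||l Xl lel] := IH g (X :\: Y); first by lia.
  exact: fcoverS (subsetDl _ _) gX.
exists (k + l)%N; last by rewrite (wt_setD E g YX) cX !natrD; lra.
apply: coverableS (leqnn _) (coverableU Yk Xl).
by apply/subsetP => v vX; rewrite !inE vX andbT orbN.
Qed.

Theorem theorem1p2 (R : realType) (H : hypergraph) (rankH : rank H = 3%N) :
  (rho H)%:R / rho_star R H <= 3 / 2 :> R.
Proof.
have rank3 e : e \in edges H -> (#|e| <= 3)%N.
  rewrite -rankH => eE.
  exact: (leq_bigmax_cond (F := fun e : {set H} => #|e|)).
have [f [f0 f1] <-] := rho_star_attained R H.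
have sum_starE v : \sum_(e in star (edges H) v) f e = \sum_(e in edges H | v \in e) f e.
  by apply: eq_bigl => e; rewrite inE.
have fT : fcover (edges H) f [set: H] by split=> // v _; rewrite sum_starE.
have [k [C [CE TC Ck]] lek] := fcover_coverable rank3 fT.
have rhok : (rho H <= k)%N.
  by apply: leq_trans Ck; apply: rho_le; rewrite /edge_cover CE -subTset.
have wtle : wt (edges H) f [set: H] [set: H] <= fsize f.
  rewrite /wt /fsize big_mkcond [leRHS]big_mkcond; apply: ler_sum => e _.
  rewrite inE; case: ifP => [/andP[/andP[-> _] _]|_] //.
  by case: ifP => // /f0.
(* Summing the constraints over all vertices counts each edge at most three times. *)
have le3 : #|[set: H]|%:R <= 3%:R * fsize f.
  apply: (@le_trans _ _ (\sum_(v in [set: H]) \sum_(e in star (edges H) v) f e)).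
    by rewrite -sumr_const; apply: ler_sum => v _; rewrite sum_starE.
  rewrite (sum_star _ _ (fun e _ => f e)).
  apply: (@le_trans _ _ (\sum_(e in meeting (edges H) [set: H]) 3%:R * f e)).
    apply: ler_sum => e; rewrite inE => /andP[eE _].
    rewrite setIT sumr_const -[leLHS]mulr_natl; apply: ler_wpM2r; first exact: f0.
    by rewrite ler_nat rank3.
  rewrite -mulr_sumr ler_wpM2l // big_mkcond [leRHS]big_mkcond; apply: ler_sum => e _.
  rewrite inE; case: ifP => [/andP[-> _]|_] //.
  by case: ifP => // /f0.
have gt0 : 0 < #|[set: H]|%:R :> R by rewrite ltr0n cardsT vertex_gt0.
have rhokR : (rho H)%:R <= k%:R :> R by rewrite ler_nat.
(* With [le3], the nonempty vertex set makes the denominator positive, and |V|/6 is at most half of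
   it. *)
by rewrite ler_pdivrMr; lra.
Qed.
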